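(* Let $n\in\mathbb N$ and let $\Xi_n,\Lambda_n$ be the polynomials defined in the context. Then $$\Xi_n(0)=\frac{(-1)^{n}}{2^{2n}(2n-1)!}\,E_{2n},\qquad \Lambda_n(0)=\frac{(-1)^{n}\,2^{2n+1}\bigl(2^{2n+2}-1\bigr)}{(2^{2n+1}-1)(n+1)(2n)!}\,B_{2n+2},$$ where $E_{2n}$ are the Euler (secant) numbers and $B_{2n+2}$ are the Bernoulli numbers.
   Context: $\mathbb N=\{1,2,3,\dots\}$. The Euler numbers are given by $\sec z=\sum_{m\ge0}\frac{(-1)^mE_{2m}}{(2m)!}z^{2m}$ (so $E_0=1$, $E_2=-1$, $E_4=5$) and the Bernoulli numbers by $\frac{z}{e^z-1}=\sum_{m\ge0}B_m\frac{z^m}{m!}$. Binomial coefficients satisfy $\binom{m}{\ell}=0$ whenever $\ell<0$ or $\ell>m$. The Eulerian number of type $A$, $\left\langle{m\atop k}\right\rangle$ ($m\ge1$, $0\le k\le m-1$), is the number of permutations of $\{1,\dots,m\}$ with exactly $k$ descents; equivalently $\sum_{j\ge0}(j+1)^m x^j=(1-x)^{-m-1}\sum_{k=0}^{m-1}\left\langle{m\atop k}\right\rangle x^k$ for $|x|<1$. The Eulerian number of type $B$, $\left\langle{m\atop k}\right\rangle^{B}$ ($m\ge0$, $0\le k\le m$), is determined by $\sum_{j\ge0}(2j+1)^m x^j=(1-x)^{-m-1}\sum_{k=0}^{m}\left\langle{m\atop k}\right\rangle^{B} x^k$ for $|x|<1$. For $n\in\mathbb N$ and $0\le t\le n-1$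 let $$\mathcal C^{(B)}_{n,t}:=\sum_{k=0}^{n-1}\left\langle {2n-1 \atop k}\right\rangle^{B}(-1)^{k}\sum_{i=0}^{k}(-1)^i\binom{k}{i}\binom{2n-2k-1}{2t-2i+1},\quad \mathcal C^{(A)}_{n,t}:=\sum_{k=0}^{n-1}\left\langle {2n \atop k}\right\rangle(-1)^{k}\sum_{i=0}^{k}(-1)^i\binom{k}{i}\binom{2n-2k-1}{2t-2i+1},$$ $$\Xi_n(x):=\frac{(-1)^{n+1}}{2^{4n-2}(2n-1)!}\sum_{t=0}^{n-1}\mathcal C^{(B)}_{n,t}\,x^{2t},\qquad \Lambda_n(x):=\frac{2(-1)^{n+1}}{(2^{2n+1}-1)(2n)!}\sum_{t=0}^{n-1}\mathcal C^{(A)}_{n,t}\,x^{2t}.$$ *)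

(* Defs.v *)
From HB Require Import structures.
From mathcomp Require Export all_boot all_order all_algebra all_fingroup.
From mathcomp Require Export all_classical all_reals all_analysis.

Export Order.TTheory GRing.Theory Num.Theory.
Export numFieldNormedType.Exports.

Set Implicit Arguments.
Unset Strict Implicit.
Unset Printing Implicit Defensive.

Local Open Scope classical_set_scope.
Local Open Scope ring_scope.

(** Only the values [E (2 * m)] are constrained. *)
Definition euler_numbers (R : realType) (E : nat -> R) : Prop :=
  \forall z \near (0 : R),
    series (fun m : nat =>
      (-1) ^+ m * E (2 * m)%N / ((2 * m)`!)%:R * z ^+ (2 * m)) @ \oo
    --> (cos z)^-1.

(** The neighbourhood is punctured because [0 / 0 = 0] here, whereas
    z / (e^z - 1) is understood as its limit 1 at z = 0. *)
Definition bernoulli_numbers (R : realType) (B : nat -> R) : Prop :=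
  \forall z \near 0^',
    series (fun m : nat => B m / (m`!)%:R * z ^+ m) @ \oo
    --> z / (expR z - 1).

(** [a m k] is constrained exactly for [0 <= k <= m]. *)
Definition eulerianB_numbers (R : realType) (a : nat -> nat -> R) : Prop :=
  forall (m : nat) (x : R), `|x| < 1 ->
    series (fun j : nat => (2 * j + 1)%:R ^+ m * x ^+ j) @ \oo
    --> (1 - x) ^- m.+1 * \sum_(0 <= k < m.+1) a m k * x ^+ k.

Definition descents (m : nat) (s : {perm 'I_m}) : {set 'I_m} :=
  [set i : 'I_m | [exists j : 'I_m, (j == i.+1 :> nat) && (s j < s i)%N]]%SET.

Definition eulerianA (m k : nat) : nat :=
  #|[set s : {perm 'I_m} | #|descents s| == k]%SET|.

(** The lower index is an integer: it can be negative below, and truncated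
    subtraction would turn the binomial into 1 instead of 0. *)
Definition binz (m : nat) (l : int) : nat :=
  match l with Posz l' => 'C(m, l') | Negz _ => 0%N end.

(** The natural subtraction [2 * n - 2 * k - 1] is exact since [k < n]. *)
Definition coefC (R : realType) (a : nat -> R) (n t : nat) : R :=
  \sum_(0 <= k < n) a k * (-1) ^+ k *
    \sum_(0 <= i < k.+1) (-1) ^+ i * ('C(k, i))%:R *
      (binz (2 * n - 2 * k - 1) ((2 * t)%:Z - (2 * i)%:Z + 1))%:R.

Definition coefCB (R : realType) (eulB : nat -> nat -> R) (n t : nat) : R :=
  coefC (eulB (2 * n - 1)%N) n t.

Definition coefCA (R : realType) (n t : nat) : R :=
  coefC (fun k => (eulerianA (2 * n) k)%:R) n t.

Definition Xi (R : realType) (eulB : nat -> nat -> R) (n : nat) : {poly R} :=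
  ((-1) ^+ n.+1 / (2 ^+ (4 * n - 2) * ((2 * n - 1)`!)%:R)) *:
    \sum_(0 <= t < n) coefCB eulB n t *: 'X^(2 * t).

Definition Lambda (R : realType) (n : nat) : {poly R} :=
  (2 * (-1) ^+ n.+1 / ((2 ^+ (2 * n + 1) - 1) * ((2 * n)`!)%:R)) *:
    \sum_(0 <= t < n) coefCA R n t *: 'X^(2 * t).

(* Main.v *)
Require Import Defs.
From mathcomp Require Import zify ring lra.

(** At [x = 0] only the terms [i = t = 0] survive, so that both claims are about
    the alternating sum of [(2n-1-2k) a_k] over [k < n], where [a_k] runs over
    one row of Eulerian numbers, of type B of order [2n-1] or of type A of order
    [2n]. Such a row [p] is a palindrome of even length [2n], and the weight
    [(-1)^k (2n-1-2k)] is invariant under the same reflection, so the sum is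
    half of [(2n-1) p(-1) + 2 p'(-1)]. The differential recurrence of the
    Eulerian polynomials expresses this combination by the value at [-1] of the
    next row. Everything thus reduces to the values at [-1] of the Eulerian
    polynomials of even order (type B) and odd order (type A).

    Both types belong to the family [eulpoly a b m], the numerator of the
    rational function [sum_j (a j + b)^m x^j] over [(1 - x)^(m+1)]; type A is
    [(1, 1)] and type B is [(2, 1)]. Shifting [b] expands binomially
    ([eulpoly_shift]), while replacing [b] by [a + b] shifts the summation index
    ([eulpoly_translate]); at [x = -1] the latter says that the values for [b]
    and [a + b] add up to [2^(m+1) b^m]. These relations are recurrences
    that determine the values at [-1]: they are the coefficientwise form of
    [beta(t) cosh(2t) = 1] for type B and of [gamma(t) (e^(2t) + 1) = 2] for
    [(1, 0)], which carries the type A values up to sign. The numbers [E] and [B]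
    satisfy the same recurrences, because [sec z * cos z = 1] and
    [(z/(e^z-1) - 2z/(e^(2z)-1)) (e^z+1) = z].

    To extract these recurrences from convergence near [0], a convergent power
    series is used only through its asymptotic expansion at [0+]: products of
    expansions are computed with truncated polynomials, and a polynomial that is
    [O(x^N)] at [0+] has no coefficient below [N].

    It remains to recognise the two Eulerian arrays. The descent numbers of
    permutations obey the recurrence of [eulpoly 1 1] by insertion of the largest
    letter. In type B, shifting the index in the defining series yields for the
    unknown polynomials the recursion satisfied by [eulpoly 2 1], in which the
    polynomial of order [m] is determined by those of smaller order. *)

Set Implicit Arguments.
Unset Strict Implicit.
Unset Printing Implicit Defensive.

(** * Eulerian permutation statistics: inserting the largest letter *)

Section InsertMax.
Variable m : nat.
Implicit Types (s : {perm 'I_m}) (p : 'I_m.+1).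

Lemma descents_lt s i : i \in descents s -> (i.+1 < m)%N.
Proof. by rewrite inE => /existsP[j /andP[/eqP <- _]]. Qed.

(** [lift_perm p ord_max s] is [s], as a word, with a new largest letter inserted
    at position [p]. The old descents move along [lift p], except that the one
    straddling the insertion point is destroyed; the new letter starts a descent
    unless it comes last. *)
Lemma descents_insert_max s p :
  descents (lift_perm p ord_max s) =
  ([set lift p i | i in [set i in descents s | i.+1 != p :> nat]]
    :|: [set i | (i == p) && (p < m)%N])%SET.
Proof.
apply/setP => i; rewrite !inE; case: (unliftP p i) => [i'|] ->.
  rewrite (mem_imset _ _ lift_inj) // !inE [_ == p]eq_sym (negPf (neq_lift _ _)) orbF.
  apply/existsP/andP.
    case=> j; case: (unliftP p j) => [j'|] ->.
      rewrite !lift_perm_lift => /andP[/eqP e]; rewrite !lift_max => lt_s.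
      split; last by apply: contra_eq_neq e => /=; rewrite /bump; lia.
      apply/existsP; exists j'; rewrite lt_s andbT; apply/eqP.
      by move: e; rewrite /= /bump; lia.
    rewrite lift_perm_id lift_perm_lift lift_max => /andP[_]; rewrite ltnNge.
    by rewrite /= ltnW.
  case=> /existsP[j' /andP[/eqP e lt_s]] ne_p.
  exists (lift p j'); rewrite !lift_perm_lift !lift_max lt_s andbT.
  by apply/eqP; move: e ne_p => /=; rewrite /bump; lia.
rewrite eqxx /=; case: imsetP => [[k _ /eqP]|_] /=.
  by rewrite (negPf (neq_lift _ _)).
apply/existsP/idP => [[j /andP[/eqP e _]]|lt_pm].
  by rewrite -ltnS -e.
exists (Ordinal (lt_pm : (p.+1 < m.+1)%N)); rewrite eqxx /= lift_perm_id.
case: (unliftP p (Ordinal (lt_pm : (p.+1 < m.+1)%N))) => [k ->|]; last first.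
  by move=> /(congr1 val) /=; lia.
by rewrite lift_perm_lift lift_max /=.
Qed.

(** The insertion positions that leave the number of descents unchanged: the end
    of the word, and the gap just after each descent. *)
Definition keeps_descents s :=
  (ord_max |: [set lift ord0 i | i in descents s])%SET.

Lemma card_keeps_descents s : #|keeps_descents s| = #|descents s|.+1.
Proof.
rewrite cardsU1 card_imset; last exact: lift_inj.
case: imsetP => // -[i /descents_lt lt_im /(congr1 val)] /=.
by rewrite /bump; lia.
Qed.

Lemma card_descents_insert_max s p :
  #|descents (lift_perm p ord_max s)| =
  (#|descents s| + (p \notin keeps_descents s))%N.
Proof.
rewrite descents_insert_max.
set B : {set 'I_m.+1} := [set i | (i == p) && _]%SET.
rewrite cardsU (_ : _ :&: B = finset.set0)%SET; last first.
  apply/setP => i; rewrite !inE; case: imsetP => // -[k _ ->].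
  by rewrite eq_sym (negPf (neq_lift _ _)).
rewrite cards0 subn0 card_imset; last exact: lift_inj.
have -> : #|B| = (p < m)%N.
  rewrite /B; case: (p < m)%N.
    rewrite (_ : [set _ | _]%SET = [set p]%SET) ?cards1 //.
    by apply/setP => i; rewrite !inE andbT.
  by apply: eq_card0 => i; rewrite !inE andbF.
rewrite !inE -val_eqE /=.
case: imsetP => [[i i_des ->]|p_nodes] /=.
  have lt_im := descents_lt i_des.
  rewrite orbT addn0 [in RHS](cardsD1 i) i_des /bump /= !add1n lt_im addnC.
  congr (_ + _)%N; apply: eq_card => j; rewrite !inE andbC eqSS.
  by rewrite val_eqE.
rewrite orbF; congr (#|pred_of_set _| + _)%N; last first.
  have := ltn_ord p; rewrite ltnS leq_eqVlt.
  by case: eqVneq => [->|]; rewrite ?ltnn //= => _ ->.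
apply/setP => i; rewrite inE; case i_des: (i \in _) => //=.
apply/eqP => e; case: p_nodes; exists i => //.
by apply: val_inj; rewrite /= /bump add1n.
Qed.

Lemma insert_max_bij :
  bijective (fun ps : 'I_m.+1 * {perm 'I_m} => lift_perm ps.1 ord_max ps.2).
Proof.
apply: inj_card_bij; last by rewrite card_prod card_ord !card_Sn factS.
move=> [p s] [p' s'] /= e.
have ep : p = p'.
  apply: (@perm_inj _ (lift_perm p' ord_max s')).
  by rewrite lift_perm_id -e lift_perm_id.
rewrite -ep in e *; congr (_, _); apply/permP => i.
by apply: (@lift_inj _ ord_max); rewrite -!(lift_perm_lift p) e.
Qed.

End InsertMax.

Lemma eulerianA_sum m k :
  eulerianA m k = (\sum_(s : {perm 'I_m}) (#|descents s| == k))%N.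
Proof.
rewrite /eulerianA -sum1_card big_mkcond; apply: eq_bigr => s _.
by rewrite inE; case: eqP.
Qed.

Lemma sum_descents_insert_max m (s : {perm 'I_m}) k :
  (\sum_p (#|descents (lift_perm p ord_max s)| == k) =
   #|descents s|.+1 * (#|descents s| == k) +
   (m - #|descents s|) * (#|descents s|.+1 == k))%N.
Proof.
rewrite (bigID (mem (keeps_descents s))) /=; congr (_ + _)%N.
  rewrite -card_keeps_descents -sum_nat_const; apply: eq_bigr => p p_keep.
  by rewrite card_descents_insert_max p_keep addn0.
have -> : (m - #|descents s| = #|~: keeps_descents s|)%N.
  by rewrite [RHS]cardsCs finset.setCK card_keeps_descents card_ord subSS.
rewrite -sum_nat_const; apply: eq_big => p; first by rewrite finset.in_setC.
by move=> p_keep; rewrite card_descents_insert_max p_keep addn1.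
Qed.

Lemma eulerianA_insert m k :
  eulerianA m.+1 k =
  (\sum_(s : {perm 'I_m}) (#|descents s|.+1 * (#|descents s| == k) +
     (m - #|descents s|) * (#|descents s|.+1 == k)))%N.
Proof.
rewrite eulerianA_sum (reindex _ (onW_bij _ (insert_max_bij m))) /=.
rewrite -(pair_bigA _ (fun p s =>
  nat_of_bool (#|descents (lift_perm p ord_max s)| == k))) //=.
by rewrite exchange_big; apply: eq_bigr => s _; rewrite sum_descents_insert_max.
Qed.

Lemma eulerianA_rec0 m : eulerianA m.+1 0 = eulerianA m 0.
Proof.
rewrite eulerianA_insert eulerianA_sum; apply: eq_bigr => s _.
by rewrite muln0 addn0; case: eqP => [->|]; rewrite ?muln0.
Qed.

Lemma eulerianA_recS m k :
  eulerianA m.+1 k.+1 = (k.+2 * eulerianA m k.+1 + (m - k) * eulerianA m k)%N.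
Proof.
rewrite eulerianA_insert !eulerianA_sum !big_distrr -big_split /=.
apply: eq_bigr => s _; rewrite eqSS; congr (_ + _)%N.
  by case: eqP => [->|]; rewrite ?muln0.
by case: eqP => [->|]; rewrite ?muln0.
Qed.

Lemma eulerianA0 k : eulerianA 0 k = (k == 0)%N.
Proof.
rewrite eulerianA_sum.
have D0 (s : {perm 'I_0}) : #|descents s| = 0 by apply: eq_card0 => -[].
by under eq_bigr do rewrite D0; rewrite sum_nat_const card_Sn mul1n eq_sym.
Qed.

Local Open Scope ring_scope.

(** * Numerators of the series of (a j + b)^m x^j *)

Section EulerianPolynomials.
Variable R : comNzRingType.
Implicit Types a b c : R.

(** The operator [b + a x d/dx], which sends [(a j + b)^m x^j] to
    [(a j + b)^(m+1) x^j], written on numerators over [(1 - x)^(m+1)]. *)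
Definition raise a b m (p : {poly R}) : {poly R} :=
  (b%:P * (1 - 'X) + a%:P * m.+1%:R * 'X) * p + a%:P * ('X * (1 - 'X)) * p^`().

Fixpoint eulpoly a b m : {poly R} :=
  if m is m'.+1 then raise a b m' (eulpoly a b m') else 1.

Lemma deriv_1subX_exp k :
  ((1 - 'X) ^+ k.+1)^`() = - k.+1%:R * (1 - 'X) ^+ k :> {poly R}.
Proof. rewrite deriv_exp derivB derivC derivX -mulr_natl -pred_Sn. ring. Qed.

(** Multiplying a numerator by a power of [1 - X] only changes the denominator
    over which the fraction is written, so [raise] commutes with it once its
    index is adjusted. *)
Lemma raise_homog a b m k p : (k <= m)%N ->
  raise a b m ((1 - 'X) ^+ (m - k) * p) = (1 - 'X) ^+ (m - k) * raise a b k p.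
Proof.
move=> /subnK; move: (m - k)%N => d <-; case: d => [|d].
  by rewrite !expr0 !mul1r.
rewrite /raise derivM deriv_1subX_exp exprS -[(_ + k).+1]addnS !natrD; ring.
Qed.

Lemma raiseD a b m : {morph raise a b m : p q / p + q}.
Proof. by move=> p q; rewrite /raise derivD; ring. Qed.

Lemma raise_sum a b m (F : nat -> {poly R}) n :
  raise a b m (\sum_(k < n) F k) = \sum_(k < n) raise a b m (F k).
Proof.
by apply: (big_morph _ (raiseD a b m)); rewrite /raise deriv0; ring.
Qed.

Lemma raiseCM a b m c p : raise a b m (c%:P * p) = c%:P * raise a b m p.
Proof. by rewrite /raise derivM derivC; ring. Qed.

Lemma raise_shift a b c m p :
  raise a (b + c) m p = raise a b m p + c%:P * (1 - 'X) * p.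
Proof. by rewrite /raise polyCD; ring. Qed.

(** Pascal's rule for the binomial transform of a sequence. *)
Lemma binomial_sumS (A : comNzRingType) (u : A) (q : nat -> A) m :
  \sum_(k < m.+2) u ^+ (m.+1 - k) * q k * 'C(m.+1, k)%:R =
  \sum_(k < m.+1) u ^+ (m - k) * q k.+1 * 'C(m, k)%:R +
  u * \sum_(k < m.+1) u ^+ (m - k) * q k * 'C(m, k)%:R.
Proof.
rewrite big_ord_recl /= bin0 subn0.
under eq_bigr do rewrite /bump /= add1n subSS binS natrD mulrDr.
rewrite big_split /= addrA addrC; congr (_ + _).
rewrite [X in _ + X]big_ord_recr /= bin_small // mulr0 addr0.
rewrite [in RHS]big_ord_recl /= bin0 subn0 mulrDr mulr_sumr; congr (_ + _).
  by rewrite !mulr1 exprS mulrA.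
apply: eq_bigr => i _; rewrite /bump /= add1n.
by rewrite -(subnSK (ltn_ord i)) exprS !mulrA.
Qed.

(** The numerators' form of the binomial expansion of
    [((a j + b) + c)^m]. *)
Lemma eulpoly_shift a b c m :
  eulpoly a (b + c) m =
  \sum_(k < m.+1) (c%:P * (1 - 'X)) ^+ (m - k) * eulpoly a b k * 'C(m, k)%:R.
Proof.
elim: m => [|m IHm]; first by rewrite big_ord1 !mul1r.
rewrite binomial_sumS [LHS]/= raise_shift -IHm; congr (_ + _).
rewrite IHm (raise_sum _ _ _
  (fun k => (c%:P * (1 - 'X)) ^+ (m - k) * eulpoly a b k * 'C(m, k)%:R)).
apply: eq_bigr => k _; rewrite -polyC_natr !exprMn -!polyC_exp.
rewrite mulrC -[(_ * _) * eulpoly a b k]mulrA !raiseCM (raise_homog _ _ _ (leq_ord k)).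
by rewrite -[eulpoly a b k.+1]/(raise a b k _); ring.
Qed.

(** The index shift [j -> j + 1] in [sum_j (a j + b)^m x^j]: the term [b^m] at
    [j = 0] is split off. *)
Lemma eulpoly_translate a b m :
  'X * eulpoly a (a + b) m =
  eulpoly a b m - (b ^+ m)%:P * (1 - 'X) ^+ m.+1.
Proof.
elim: m => [|m IHm]; first by rewrite /= mulr1 expr0 expr1 mul1r; ring.
have -> : 'X * eulpoly a (a + b) m.+1 = raise a b m ('X * eulpoly a (a + b) m).
  by rewrite /= /raise derivM derivX polyCD; ring.
rewrite IHm raiseD /=; congr (_ + _).
rewrite -mulrN raiseCM /raise derivN deriv_1subX_exp !exprS polyCM.
by rewrite -(@natr1 _ m); ring.
Qed.

Lemma raise_expand a b m p :
  raise a b m p =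
  b%:P * p + (a * m.+1%:R - b)%:P * ('X * p) +
  a%:P * ('X * p^`()) - a%:P * ('X * ('X * p^`())).
Proof. by rewrite /raise polyCB polyCM polyC_natr; ring. Qed.

Lemma coef_raise0 a b m p : (raise a b m p)`_0 = b * p`_0.
Proof.
rewrite raise_expand !(coefD, coefN, coefCM, coefXM) /=; ring.
Qed.

Lemma coef_raiseS a b m p k :
  (raise a b m p)`_k.+1 =
  (b + a * k.+1%:R) * p`_k.+1 + (a * m.+1%:R - b - a * k%:R) * p`_k.
Proof.
rewrite raise_expand !(coefD, coefN, coefCM, coefXM, coef_deriv) /=.
by case: k => [|k] /=; rewrite ?coef_deriv; ring.
Qed.

Lemma eulpoly_coef_gt a b m k : (m < k)%N -> (eulpoly a b m)`_k = 0.
Proof.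
elim: m k => [|m IHm] [|k] //= lt_mk; first by rewrite coef1.
by rewrite coef_raiseS !IHm // 1?ltnW // !mulr0 addr0.
Qed.

Lemma size_eulpoly a b m : (size (eulpoly a b m) <= m.+1)%N.
Proof. by apply/leq_sizeP => k; exact: eulpoly_coef_gt. Qed.

(** The coefficient recurrence is exchanged with that for [a - b] when the
    coefficients are read backwards. Type B, where [a - b = b], is thus
    palindromic; type A becomes so through [eulpoly_translate] with [b = 0]. *)
Lemma eulpoly_reverse a b m k : (k <= m)%N ->
  (eulpoly a b m)`_k = (eulpoly a (a - b) m)`_(m - k).
Proof.
elim: m k => [|m IHm] [|k] //= le_km.
  rewrite coef_raise0 coef_raiseS (eulpoly_coef_gt _ _ (ltnSn m)) (IHm 0%N) // subn0.
  by rewrite -natr1; ring.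
rewrite subSS coef_raiseS; move: (le_km); rewrite leq_eqVlt.
case/predU1P => [[->]|lt_km].
  rewrite subnn coef_raise0 (eulpoly_coef_gt _ _ (ltnSn m)) (IHm m) // subnn.
  by rewrite -natr1; ring.
have lt_km' : (k < m)%N by [].
rewrite (IHm k.+1) // (IHm k) // -[in RHS](subnSK lt_km') coef_raiseS.
by rewrite (subnSK lt_km') !natrB -?natr1 //; ring.
Qed.
End EulerianPolynomials.

Lemma eulpoly11_coef (R : comNzRingType) m k :
  (eulpoly (1 : R) 1 m)`_k = (eulerianA m k)%:R.
Proof.
elim: m k => [|m IHm] k; first by rewrite /= coef1 eulerianA0.
case: k => [|k] /=.
  by rewrite coef_raise0 mul1r eulerianA_rec0 IHm.
rewrite coef_raiseS eulerianA_recS natrD !natrM -!IHm.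
congr (_ + _); first by rewrite mul1r nat1r.
case: (leqP k m) => [le_km|lt_mk]; last by rewrite eulpoly_coef_gt ?mulr0.
by rewrite natrB // -natr1; congr (_ * _); ring.
Qed.

(** * Values at -1 and half sums of palindromic rows *)

Lemma sum_palindrome (V : nmodType) (g : nat -> V) n :
  (forall k, (k < 2 * n)%N -> g (2 * n - 1 - k)%N = g k) ->
  \sum_(0 <= k < 2 * n) g k = (\sum_(0 <= k < n) g k) *+ 2.
Proof.
move=> g_sym; have le_n2n : (n <= 2 * n)%N by lia.
rewrite (big_cat_nat (n := n)) //= mulr2n; congr (_ + _).
rewrite big_nat_rev -[n in X in _ = X]addn0 -{1}[n]add0n.
rewrite (_ : 2 * n = n + n)%N; last lia.
rewrite big_addn addnK addn0; apply: eq_big_nat => k /andP[_ lt_kn].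
rewrite -[RHS]g_sym; last lia.
by congr g; lia.
Qed.

Section ValuesAtMinusOne.
Variable R : comNzRingType.
Implicit Types a b c : R.

(** The weights [(-1)^k (c - 2k)] come from [p] and [x p'] at [-1]. *)
Lemma weighted_sum_horner (p : {poly R}) c N : (size p <= N)%N ->
  \sum_(0 <= k < N) p`_k * (-1) ^+ k * (c - k.*2%:R) =
  c * p.[-1] + (p^`()).[-1] *+ 2.
Proof.
move=> le_pN; have defp : p = \sum_(k < N) p`_k *: 'X^k.
  rewrite -[LHS]coefK poly_def (big_ord_widen _ (fun k => p`_k *: 'X^k) le_pN).
  rewrite big_mkcond; apply: eq_bigr => k _; case: ltnP => // le_pk.
  by rewrite nth_default // scale0r.
rewrite {2 3}defp raddf_sum !horner_sum mulr_sumr -sumrMnl -big_split big_mkord.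
apply: eq_bigr => k _ /=; rewrite derivZ derivXn !(hornerZ, hornerMn, hornerXn).
case: (nat_of_ord k) => [|j] /=.
  by rewrite mulr0n !mulr0 mul0rn; ring.
by rewrite exprS -mul2n natrM; ring.
Qed.

Definition eulval a b m : R := (eulpoly a b m).[-1].

(** For the palindromic rows met below, the right-hand side is a multiple of the
    combination of [weighted_sum_horner], whence the passage to the next
    order. *)
Lemma eulvalS a b m :
  eulval a b m.+1 =
  (b *+ 2 - a * m.+1%:R) * eulval a b m - a * (eulpoly a b m)^`().[-1] *+ 2.
Proof.
rewrite /eulval /= /raise -polyC_natr.
rewrite !(hornerD, hornerN, hornerM, hornerC, hornerX).
ring.
Qed.

Lemma eulval_translate a b m :
  eulval a (a + b) m + eulval a b m = b ^+ m * 2 ^+ m.+1.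
Proof.
have /(congr1 (fun p => p.[-1])) := eulpoly_translate a b m.
rewrite !(hornerM, hornerD, hornerN, hornerX, hornerC, horner_exp).
rewrite -/(eulval _ _ _) -/(eulval _ _ _).
rewrite opprK mulN1r => /(congr1 (fun x => - x)); rewrite opprK => ->.
rewrite (_ : 1 + 1 = 2%:R) //; ring.
Qed.

Lemma eulval_shift a b c m :
  eulval a (b + c) m =
  \sum_(k < m.+1) (c *+ 2) ^+ (m - k) * eulval a b k * 'C(m, k)%:R.
Proof.
rewrite /eulval (eulpoly_shift a b c m) horner_sum; apply: eq_bigr => k _.
rewrite -polyC_natr !(hornerM, hornerD, hornerN, hornerX, hornerC, horner_exp).
by rewrite opprK mulr2n mulrDr mulr1.
Qed.
End ValuesAtMinusOne.

(** For [t = 0] the lower index [1 - 2i] is nonnegative only at [i = 0], where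
    the binomial is [2n - 2k - 1]. *)
Lemma coefC_0 (R : realType) (f : nat -> R) n :
  coefC f n 0 = \sum_(0 <= k < n) f k * (-1) ^+ k * ((2 * n - 1)%:R - k.*2%:R).
Proof.
rewrite /coefC; apply: eq_big_nat => k /andP[_ lt_kn].
rewrite big_ltn // big1_seq; last first.
  move=> [|i]; rewrite ?mem_iota // => _.
  have -> : (2 * 0)%:Z - (2 * i.+1)%:Z + 1 = Negz (2 * i) by lia.
  by rewrite mulr0.
rewrite muln0 subrr add0r addr0 expr0 bin0 !mul1r /= bin1.
by congr (_ * _); rewrite -natrB; [congr (_%:R); lia|lia].
Qed.

Lemma horner0_even_sum (R : comNzRingType) (f : nat -> R) n : (0 < n)%N ->
  (\sum_(0 <= t < n) f t *: 'X^(2 * t)).[0] = f 0%N.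
Proof.
move=> n_gt0; rewrite big_ltn // hornerD horner_sum big1_seq ?addr0.
  by rewrite muln0 expr0 !hornerE.
move=> [|t]; rewrite ?mem_iota // => _.
by rewrite hornerZ hornerXn mulnS expr0n mulr0.
Qed.

(** Under [k -> 2n-1-k] both the sign [(-1)^k] and the factor [2n-1-2k] change
    sign, so the sum over [k < n] is half of the full one. *)
Lemma coefC_0_palindrome (R : realType) (p : {poly R}) n : (0 < n)%N ->
  (size p <= 2 * n)%N ->
  (forall k, (k < 2 * n)%N -> p`_(2 * n - 1 - k) = p`_k) ->
  coefC (fun k => p`_k) n 0 *+ 2 = (2 * n - 1)%:R * p.[-1] + p^`().[-1] *+ 2.
Proof.
move=> n_gt0 le_p p_sym; rewrite coefC_0 -(weighted_sum_horner _ le_p).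
rewrite sum_palindrome // => k lt_k.
rewrite p_sym // -!mulrA; congr (_ * _).
have : (-1) ^+ (2 * n - 1 - k) = - (-1) ^+ k :> R.
  rewrite -signr_odd (_ : odd _ = ~~ odd k) ?signrN ?signr_odd //; lia.
move=> ->; rewrite mulNr -mulrN; congr (_ * _).
have -> : (2 * n - 1 - k).*2%:R = (2 * n - 1)%:R *+ 2 - k.*2%:R :> R.
  by rewrite -!muln2 !natrM natrB; [ring | lia].
ring.
Qed.

Lemma coefC_0_eulpoly21 (R : realType) n : (0 < n)%N ->
  coefC (fun k => (eulpoly (2 : R) 1 (2 * n - 1))`_k) n 0 *+ 4 =
  - eulval (2 : R) 1 (2 * n).
Proof.
move=> n_gt0; have def2n : (2 * n)%N = (2 * n - 1).+1 by lia.
rewrite (mulrnA _ 2 2) coefC_0_palindrome //.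
- rewrite [in RHS]def2n eulvalS -def2n -/(eulval _ _ _).
  have -> : (2 * n)%:R = (2 * n - 1)%:R + 1 :> R by rewrite natr1 -def2n.
  ring.
- by rewrite {2}def2n size_eulpoly.
move=> k lt_k; rewrite eulpoly_reverse ?leq_subr //.
by congr ((eulpoly _ _ _)`_ _); [ring | lia].
Qed.

Lemma coefC_0_eulpoly11 (R : realType) n : (0 < n)%N ->
  coefC (fun k => (eulpoly (1 : R) 1 (2 * n))`_k) n 0 *+ 2 =
  - eulval (1 : R) 1 (2 * n).+1.
Proof.
move=> n_gt0.
(* [X * eulpoly 1 1 (2 * n) = eulpoly 1 0 (2 * n)]: the palindrome is centred
   at [n - 1/2]. *)
have defQ k :
    (eulpoly (1 : R) 1 (2 * n))`_k = (eulpoly (1 : R) 0 (2 * n))`_k.+1.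
  have := congr1 (fun p : {poly R} => p`_k.+1) (eulpoly_translate (1 : R) 0 (2 * n)).
  rewrite addr0 coefXM expr0n muln_eq0 /= eqn0Ngt n_gt0 => ->.
  by rewrite polyC0 mul0r subr0.
have size_Q : (size (eulpoly (1 : R) 1 (2 * n)) <= 2 * n)%N.
  by apply/leq_sizeP => k le_k; rewrite defQ eulpoly_coef_gt.
rewrite coefC_0_palindrome //.
  rewrite eulvalS -/(eulval _ _ _) -[(2 * n).+1%:R]natr1 natrB; [ring|lia].
move=> k lt_k; rewrite eulpoly_reverse; last lia.
by rewrite subrr defQ; congr ((eulpoly _ _ _)`_ _); lia.
Qed.

(** * Asymptotic expansions at 0 from the right *)

Lemma geometric_sum_le2 (R : realFieldType) (q : R) n : 0 <= q <= 2^-1 ->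
  \sum_(i < n) q ^+ i <= 2.
Proof.
move=> /andP[q_ge0 q_le].
suff: \sum_(i < n) q ^+ i <= 2 - 2 * q ^+ n.
  by move/le_trans; apply; rewrite gerBl mulr_ge0 // exprn_ge0.
elim: n => [|n IHn]; first by rewrite big_ord0 expr0; lra.
rewrite big_ord_recr /= exprS.
have : q * q ^+ n <= 2^-1 * q ^+ n by rewrite ler_wpM2r // exprn_ge0.
lra.
Qed.

Section AsymptoticExpansions.
Local Open Scope classical_set_scope.
Variable R : realType.
Implicit Types (f g h : R -> R) (c d e : nat -> R) (p : {poly R}).

(** Only the right-hand side of [0] is used: it makes the substitution
    [w = z^2] available for even series. *)
Definition asymptotic f c := forall N, exists K, \forall x \near 0^'+,
  `|f x - (\poly_(i < N) c i).[x]| <= K * x ^+ N.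

Lemma horner_poly_series c N x :
  (\poly_(i < N) c i).[x] = series (fun m => c m * x ^+ m) N.
Proof. by rewrite horner_poly seriesEnat /= big_mkord. Qed.

(** Convergence at one point [x0 > 0] bounds [c_m x0^m]; for [x <= x0 / 2] the
    tail from [N] on is then dominated by a geometric series of ratio at most
    [1/2]. *)
Lemma series_asymptotic f c :
  (\forall x \near 0^'+, series (fun m => c m * x ^+ m) @ \oo --> f x) ->
  asymptotic f c.
Proof.
move=> cvg_f N.
have [x0 [x0_gt0 cvg_x0]] : exists x0, 0 < x0 /\
    series (fun m => c m * x0 ^+ m) @ \oo --> f x0.
  by apply: (@filter_ex _ (0 : R)^'+); near=> x; split; near: x => //; exact: nbhs_right_gt.
have /cvg_series_bounded/pinfty_ex_gt0[M M_gt0 le_M] :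
  cvgn (series (fun m => c m * x0 ^+ m)) by apply/cvg_ex; exists (f x0).
exists (2 * M / x0 ^+ N); near=> x.
have x_gt0 : 0 < x by near: x; exact: nbhs_right_gt.
have x_le : x <= x0 / 2 by near: x; apply: nbhs_right_le; lra.
have cvg_x : series (fun m => c m * x ^+ m) @ \oo --> f x by near: x.
have cvg_tail : `|series (fun m => c m * x ^+ m) n - (\poly_(i < N) c i).[x]|
    @[n --> \oo] --> `|f x - (\poly_(i < N) c i).[x]|.
  by apply: cvg_norm; apply: cvgB => //; exact: cvg_cst.
rewrite -(cvg_lim (@Rhausdorff R) cvg_tail); apply: limr_le.
  by apply/cvg_ex; eexists; exact: cvg_tail.
near=> n; have le_Nn : (N <= n)%N by near: n; exact: nbhs_infty_ge.
rewrite horner_poly_series sub_series_geq //.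
set q := x / x0.
have q_ge0 : 0 <= q by rewrite divr_ge0 // ltW.
have q_le : q <= 2^-1 by rewrite ler_pdivrMr // mulrC.
apply: (@le_trans _ _ (\sum_(N <= k < n) M * q ^+ k)).
  apply: le_trans (ler_norm_sum _ _ _) _; apply: ler_sum => k _.
  have -> : c k * x ^+ k = c k * x0 ^+ k * q ^+ k.
    by rewrite /q expr_div_n; field; rewrite expf_neq0 // gt_eqF.
  rewrite normrM [`|q ^+ k|]ger0_norm ?exprn_ge0 //.
  by rewrite ler_wpM2r ?exprn_ge0 // le_M.
rewrite -mulr_sumr -[N in X in X <= _]add0n big_addn big_mkord.
under eq_bigr do rewrite exprD.
rewrite -mulr_suml.
have -> : 2 * M / x0 ^+ N * x ^+ N = M * (2 * q ^+ N).
  by rewrite /q expr_div_n; ring.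
by rewrite (ler_wpM2l (ltW M_gt0)) // ler_wpM2r ?exprn_ge0 // geometric_sum_le2 // q_ge0.
Unshelve. all: by end_near. Qed.

Lemma horner_le1 p x : 0 <= x <= 1 -> `|p.[x]| <= \sum_(i < size p) `|p`_i|.
Proof.
move=> /andP[x_ge0 x_le1]; rewrite horner_coef.
apply: le_trans (ler_norm_sum _ _ _) _; apply: ler_sum => k _.
rewrite normrM ler_piMr // normrX ger0_norm //.
by rewrite exprn_ile1.
Qed.

Lemma asymptotic_poly p : asymptotic (horner p) (fun i => p`_i).
Proof.
move=> N; exists (\sum_(i < size (drop_poly N p)) `|(drop_poly N p)`_i|).
near=> x; have x01 : 0 <= x <= 1.
  apply/andP; split; near: x; [exact: nbhs_right_ge|].
  by apply: nbhs_right_le.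
have /andP[x_ge0 _] := x01.
rewrite -/(take_poly N p) -{1}(poly_take_drop N p) hornerD hornerM hornerXn.
rewrite addrAC subrr add0r normrM [`|x ^+ N|]ger0_norm ?exprn_ge0 //.
by rewrite ler_wpM2r ?exprn_ge0 // horner_le1.
Unshelve. all: by end_near. Qed.

(** Letting [x -> 0+] kills the constant coefficient, and dividing by [X] lowers
    [N] by one. *)
Lemma coef_eq0_of_bigO p N K :
  (\forall x \near 0^'+, `|p.[x]| <= K * x ^+ N) ->
  forall i, (i < N)%N -> p`_i = 0.
Proof.
elim: N p => [//|N IHN] p p_small.
have p0 : p.[0] = 0.
  apply/eqP; rewrite -normr_le0.
  have cvg_p : `|p.[x]| - K * x ^+ N.+1 @[x --> 0^'+] -->
      `|p.[0]| - K * 0 ^+ N.+1.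
    apply: cvg_at_right_filter; apply: cvgB.
      by apply: cvg_norm; exact: continuous_horner.
    by apply: cvgMr; exact: exprn_continuous.
  rewrite expr0n mulr0 subr0 in cvg_p.
  rewrite -(cvg_lim (@Rhausdorff R) cvg_p); apply: limr_le.
    by apply/cvg_ex; eexists; exact: cvg_p.
  by apply: filterS p_small => x; rewrite subr_le0.
have /factor_theorem[q def_p] : root p 0 by apply/eqP.
have q0 : forall i, (i < N)%N -> q`_i = 0.
  apply: IHN; near=> x.
  have x_gt0 : 0 < x by near: x; exact: nbhs_right_gt.
  rewrite -(ler_pM2r x_gt0) -mulrA -exprSr.
  have -> : `|q.[x]| * x = `|p.[x]|.
    by rewrite def_p hornerM hornerXsubC subr0 normrM (gtr0_norm x_gt0).
  by near: x.
move=> [|i] lt_iN; first by rewrite -horner_coef0.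
by rewrite def_p subr0 coefMX /= q0.
Unshelve. all: by end_near. Qed.

(** Replaces the Cauchy product and the uniqueness of power series at once: the
    product of the truncations differs from the truncation of [h] by a polynomial
    that is [O(x^N)]. *)
Lemma asymptotic_mul f g h c d e :
  asymptotic f c -> asymptotic g d -> asymptotic h e ->
  (\forall x \near 0^'+, f x * g x = h x) ->
  forall m, \sum_(i < m.+1) c i * d (m - i)%N = e m.
Proof.
move=> /[swap] /[swap] fc gd he fgh m; set N := m.+1.
have [[Kf fC] [Kg gD] [Kh hE]] := And3 (fc N) (gd N) (he N).
pose C := \poly_(i < N) c i; pose D := \poly_(i < N) d i.
pose E := \poly_(i < N) e i.
pose B p := \sum_(i < size p) `|p`_i|.
have CD_E i : (i < N)%N -> (C * D - E)`_i = 0.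
  apply: (@coef_eq0_of_bigO _ _ (B C * Kg + Kf * Kg + Kf * B D + Kh)).
  near=> x.
  have x_gt0 : 0 < x by near: x; exact: nbhs_right_gt.
  have x01 : 0 <= x <= 1 by rewrite ltW //=; near: x; exact: nbhs_right_le.
  have xN_ge0 : 0 <= x ^+ N by rewrite exprn_ge0 ?ltW.
  have fx : `|f x - C.[x]| <= Kf * x ^+ N by near: x.
  have gx : `|g x - D.[x]| <= Kg * x ^+ N by near: x.
  have hx : `|h x - E.[x]| <= Kh * x ^+ N by near: x.
  have Kf_ge0 : 0 <= Kf * x ^+ N by exact: le_trans fx.
  have Kg_ge0 : 0 <= Kg.
    by rewrite -(pmulr_lge0 _ (exprn_gt0 N x_gt0)); exact: le_trans gx.
  have xN_le1 : x ^+ N <= 1 by case/andP: x01 => ? ?; exact: exprn_ile1.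
  have fgx : f x * g x = h x by near: x.
  have -> : (C * D - E).[x] = (h x - E.[x]) - (C.[x] * (g x - D.[x]) +
      (f x - C.[x]) * (g x - D.[x]) + (f x - C.[x]) * D.[x]).
    by rewrite !hornerE -fgx; ring.
  have CgD : `|C.[x] * (g x - D.[x])| <= B C * (Kg * x ^+ N).
    by rewrite normrM ler_pM ?horner_le1.
  have CfD : `|(f x - C.[x]) * D.[x]| <= Kf * x ^+ N * B D.
    by rewrite normrM ler_pM ?horner_le1.
  have CfgD : `|(f x - C.[x]) * (g x - D.[x])| <= Kf * x ^+ N * Kg.
    rewrite normrM ler_pM //; apply: le_trans gx _.
    by rewrite ler_piMr.
  apply: le_trans (ler_normB _ _) _.
  apply: le_trans (lerD hx (ler_normD _ _)) _.
  apply: le_trans (lerD (lexx _) (lerD (ler_normD _ _) (lexx _))) _.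
  lra.
have := CD_E m (ltnSn m).
rewrite coefB coefM [E`_m]coef_poly ltnSn => /eqP; rewrite subr_eq0 => /eqP <-.
apply: eq_bigr => i _; rewrite !coef_poly ltn_ord.
by rewrite ltnS leq_subr.
Unshelve. all: by end_near. Qed.

End AsymptoticExpansions.

(** * Recurrences of the Euler and Bernoulli numbers *)

Lemma fact_neq0 (R : numFieldType) n : n`!%:R != 0 :> R.
Proof. by rewrite pnatr_eq0 -lt0n fact_gt0. Qed.

Lemma bin_factV (R : numFieldType) n i : (i <= n)%N ->
  'C(n, i)%:R = n`!%:R / (i`!%:R * (n - i)`!%:R) :> R.
Proof.
by move=> le_in; rewrite -(bin_fact le_in) !natrM mulfK // mulf_neq0 ?fact_neq0.
Qed.

Lemma sum_even (V : nmodType) (F : nat -> V) n : (forall i, odd i -> F i = 0) ->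
  \sum_(i < (2 * n).+1) F i = \sum_(i < n.+1) F (2 * i)%N.
Proof.
move=> F_odd; elim: n => [|n IHn]; first by rewrite !big_ord1.
rewrite [RHS]big_ord_recr -IHn mulnS !big_ord_recr /=.
by rewrite (F_odd (2 * n).+1) ?addr0 //= oddM.
Qed.

Section NumberSequences.
Variable R : realType.
Local Open Scope classical_set_scope.

Lemma nbhs_right_of_nbhs (P : set R) (x : R) :
  (\forall z \near x, P z) -> \forall z \near x^'+, P z.
Proof.
by move=> near_P; near=> z; near: z; exact: cvg_within near_P.
Unshelve. all: by end_near. Qed.

(** The coefficients of [sec z * cos z = 1], as power series in [w = z^2]. *)
Lemma euler_secant_rec (E : nat -> R) : euler_numbers E -> forall m,
  \sum_(i < m.+1) 'C(2 * m, 2 * i)%:R * E (2 * i)%N = (m == 0%N)%:R.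
Proof.
move=> hE m.
have sqrt_cvg0 : Num.sqrt x @[x --> (0 : R)^'+] --> (0 : R).
  rewrite -[X in _ --> X]sqrtr0; apply: cvg_at_right_filter.
  exact: sqrt_continuous.
pose f (w : R) := (cos (Num.sqrt w))^-1.
pose g (w : R) := cos (Num.sqrt w).
pose c i : R := (-1) ^+ i * E (2 * i)%N / (2 * i)`!%:R.
pose d i : R := (-1) ^+ i / (2 * i)`!%:R.
have fc : asymptotic f c.
  apply: series_asymptotic.
  have := sqrt_cvg0 _ hE; rewrite /= nbhs_filterE => hE'.
  near=> w; have w_ge0 : 0 <= w by near: w; exact: nbhs_right_ge.
  have -> : (fun i => c i * w ^+ i) =
      (fun i => (-1) ^+ i * E (2 * i)%N / (2 * i)`!%:R * Num.sqrt w ^+ (2 * i)).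
    by apply/funext => i; rewrite exprM sqr_sqrtr.
  by near: w.
have gd : asymptotic g d.
  apply: series_asymptotic; near=> w.
  have w_ge0 : 0 <= w by near: w; exact: nbhs_right_ge.
  have -> : (fun i => d i * w ^+ i) = cos_coeff' (Num.sqrt w).
    apply/funext => i; rewrite /cos_coeff' -mul2n exprM sqr_sqrtr // /d.
    by rewrite -exprnP; ring.
  exact: cvg_cos_coeff'.
have fg1 : \forall w \near (0 : R)^'+, f w * g w = (1%:P : {poly R}).[w].
  have cos_cvg1 : cos (Num.sqrt x) @[x --> (0 : R)^'+] --> (1 : R).
    rewrite -[X in _ --> X]cos0; apply: (cvg_comp _ _ sqrt_cvg0).
    exact: continuous_cos.
  near=> w; rewrite hornerC mulVf // gt_eqF //.
  near: w; apply: (cvgr_gt _ cos_cvg1); exact: ltr01.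
have := asymptotic_mul fc gd (asymptotic_poly (1%:P : {poly R})) fg1 m.
rewrite poly.coefC => /(congr1 (fun x => (-1) ^+ m * (2 * m)`!%:R * x)).
rewrite mulr_sumr => e.
transitivity ((-1) ^+ m * (2 * m)`!%:R * (if m == 0%N then 1 else 0) : R).
  rewrite -e; apply: eq_bigr => i _; have le_im : (i <= m)%N by rewrite -ltnS.
  rewrite /c /d bin_factV ?leq_mul2l // -mulnBr.
  have -> : (-1) ^+ m = (-1) ^+ i * (-1) ^+ (m - i) :> R by rewrite -exprD subnKC.
  set s := (-1) ^+ i; set t := (-1) ^+ (m - i).
  have s2 : s * s = 1 by rewrite -expr2 sqrr_sign.
  have t2 : t * t = 1 by rewrite -expr2 sqrr_sign.
  transitivity ((2 * m)`!%:R / ((2 * i)`!%:R * (2 * (m - i))`!%:R) *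
      E (2 * i)%N * (s * s) * (t * t)).
    by rewrite s2 t2; ring.
  by field; rewrite !fact_neq0.
by case: m {e} => [|m]; rewrite ?mulr0 // expr0 !mulr1.
Unshelve. all: by end_near. Qed.

(** The function [z/(e^z-1) - 2z/(e^(2z)-1)] equals [z/(e^z+1)] and has
    coefficients [(1 - 2^i) B_i / i!]; multiply it by [e^z + 1]. *)
Lemma bernoulli_half_rec (B : nat -> R) : bernoulli_numbers B -> forall m,
  let y i := (1 - 2 ^+ i.+1) * B i.+1 / (i.+1)%:R in
  \sum_(i < m.+1) 'C(m, i)%:R * y i + y m = (m == 0%N)%:R.
Proof.
move=> hB m y.
pose f (z : R) := z / (expR z - 1) - 2 * z / (expR (2 * z) - 1).
pose g (z : R) := expR z + 1.
pose c i := (1 - 2 ^+ i) * B i / i`!%:R.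
pose d i : R := i`!%:R^-1 + (i == 0%N)%:R.
have hB' : \forall z \near (0 : R), z != 0 ->
    series (fun i => B i / i`!%:R * z ^+ i) @ \oo --> z / (expR z - 1) := hB.
have hB_right : \forall z \near (0 : R)^'+,
    series (fun i => B i / i`!%:R * z ^+ i) @ \oo --> z / (expR z - 1).
  near=> z; have : z != 0 by near: z; exact: nbhs_right_neq.
  by near: z; exact: nbhs_right_of_nbhs hB'.
have hB_right2 : \forall z \near (0 : R)^'+,
    series (fun i => B i / i`!%:R * (2 * z) ^+ i) @ \oo -->
      2 * z / (expR (2 * z) - 1).
  have double_cvg0 : 2 * z @[z --> (0 : R)] --> (0 : R).
    by rewrite -[X in _ --> X](mulr0 2); exact: mulrl_continuous.
  near=> z; have : 2 * z != 0.
    by rewrite mulf_neq0 ?pnatr_eq0 //; near: z; exact: nbhs_right_neq.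
  by near: z; exact: nbhs_right_of_nbhs (double_cvg0 _ hB').
have fc : asymptotic f c.
  apply: series_asymptotic; near=> z.
  have -> : (fun i => c i * z ^+ i) = (fun i => B i / i`!%:R * z ^+ i) -
      (fun i => B i / i`!%:R * (2 * z) ^+ i).
    by apply/funext => i; rewrite /c !fctE exprMn; ring.
  rewrite seriesD seriesN; apply: cvgB; near: z => //.
have gd : asymptotic g d.
  apply: series_asymptotic; near=> z.
  have -> : (fun i => d i * z ^+ i) = exp_coeff z + (fun i => (i == 0%N)%:R).
    apply/funext => i; rewrite /d /exp_coeff !fctE.
    case: i => [|i] /=; first by rewrite fact0 invr1 expr0 !mulr1.
    by rewrite !addr0 mulrC.
  rewrite seriesD; apply: cvgD; first exact: is_cvg_series_exp_coeff.
  apply: cvg_near_cst; near=> n; have n_gt0 : (0 < n)%N by near: n; exact: nbhs_infty_gt.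
  rewrite -(prednK n_gt0) seriesEnat /= big_nat_recl // big1 ?addr0 //.
have fgX : \forall z \near (0 : R)^'+, f z * g z = ('X : {poly R}).[z].
  near=> z; have z_gt0 : 0 < z by near: z; exact: nbhs_right_gt.
  have e_gt1 : 1 < expR z by rewrite expR_gt1.
  rewrite hornerX /f /g; have -> : expR (2 * z) = expR z ^+ 2.
    by rewrite mulrC -[2]/(2%:R) expRM_natr.
  field; apply/andP; split; apply: lt0r_neq0; nra.
have := asymptotic_mul fc gd (asymptotic_poly ('X : {poly R})) fgX m.+1.
(* The coefficient of index [0] vanishes, hence the shift of [B] by one. *)
rewrite big_ord_recl {1}/c expr0 subrr !mul0r add0r coefX eqSS.
move=> /(congr1 (fun x => m`!%:R * x)) e.
transitivity (m`!%:R * (m == 0%N)%:R : R); last first.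
  by case: (m) => [|m']; rewrite ?mulr0 ?mulr1.
rewrite -e mulr_sumr [in RHS]big_ord_recr [in LHS]big_ord_recr /=.
have c_y i : c i.+1 = y i / i`!%:R.
  by rewrite /c /y factS natrM invfM mulrA.
rewrite -addrA; congr (_ + _).
  apply: eq_bigr => i _; rewrite /bump /= add1n subSS c_y /d subn_eq0 leqNgt ltn_ord.
  rewrite addr0 bin_factV 1?ltnW //; field; rewrite !fact_neq0 //.
rewrite /bump /= add1n subnn c_y /d binn fact0 invr1 eqxx.
by rewrite /=; field; rewrite fact_neq0.
Unshelve. all: by end_near. Qed.

(** The translation and shift relations give, for [gamma_m = eulval 1 0 m], the
    coefficients of [gamma(t) (e^(2t) + 1) = 2]; rescaling by [2^m] turns this
    into the recurrence of [bernoulli_half_rec]. *)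
Lemma eulval10_bernoulli (B : nat -> R) : bernoulli_numbers B -> forall m,
  eulval (1 : R) 0 m =
  2 ^+ m.+1 * ((1 - 2 ^+ m.+1) * B m.+1 / m.+1%:R).
Proof.
move=> /bernoulli_half_rec hB; elim/ltn_ind => m IHm.
move: (hB m) => /=; set y := fun i : nat => (1 - 2 ^+ i.+1) * B i.+1 / i.+1%:R.
rewrite -/(y m) (eq_bigr (fun i : 'I_m.+1 => 'C(m, i)%:R * y i)) // => y_rec.
have := eulval_translate (1 : R) 0 m.
rewrite addr0 -[X in eulval _ X m]add0r eulval_shift !big_ord_recr /= in y_rec *.
rewrite !binn subnn expr0 !mul1r mulr1 in y_rec *.
have -> : \sum_(i < m) (1 *+ 2) ^+ (m - i) * eulval (1 : R) 0 i * 'C(m, i)%:R =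
    2 ^+ m.+1 * \sum_(i < m) 'C(m, i)%:R * y i.
  rewrite mulr_sumr; apply: eq_bigr => i _.
  rewrite (IHm i) // -/(y i).
  have -> : 2 ^+ m.+1 = 2 ^+ (m - i) * 2 ^+ i.+1 :> R.
    by rewrite -exprD addnS subnK // ltnW.
  ring.
rewrite expr0n -y_rec => eul_rec.
have := pnatr_eq0 R 2; move: eul_rec; lra.
Qed.

(** The values for [b = 2] and [b = 0], expanded around [b = 1] with the
    opposite increments [1] and [-1], combine into a hyperbolic cosine: only the
    terms of even index remain. *)
Lemma eulval21_rec n :
  \sum_(i < n.+1) 'C(2 * n, 2 * i)%:R * (eulval (2 : R) 1 (2 * i) / 4 ^+ i) =
  (n == 0%N)%:R.
Proof.
pose F k : R := ((2 : R) ^+ (2 * n - k) + (- 2) ^+ (2 * n - k)) *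
  eulval (2 : R) 1 k * 'C(2 * n, k)%:R.
have sumF : \sum_(k < (2 * n).+1) F k = 2 * (n == 0%N)%:R.
  have up := eulval_shift (2 : R) 1 1 (2 * n).
  have down := eulval_shift (2 : R) 1 (- 1) (2 * n).
  have := eulval_translate (2 : R) 0 (2 * n).
  rewrite addr0 -{1}[2]/(1 + 1 : R) -[X in _ + eulval _ X _](subrr (1 : R)).
  rewrite -[X in eulval X _ _]/(2 : R) in up *.
  rewrite up down -big_split /= expr0n muln_eq0 /= => sumE.
  transitivity ((n == 0)%N%:R * (2 : R) ^+ (2 * n).+1).
    rewrite -sumE; apply: eq_bigr => k _; rewrite /F.
    by rewrite mulNrn !mulrDl.
  by case: (n) => [|n']; rewrite ?mul0r ?mulr0 // muln0 expr1 mulrC.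
have F_odd k : odd k -> F k = 0.
  move=> k_odd; case: (leqP k (2 * n)) => [le_k|lt_k]; last first.
    by rewrite /F bin_small ?mulr0.
  rewrite /F exprNn -signr_odd oddB // k_odd oddM /=.
  by rewrite expr1 mulN1r subrr !mul0r.
rewrite (sum_even _ F_odd) in sumF.
apply: (mulfI (_ : 2 * 4 ^+ n != 0)).
  by rewrite mulf_neq0 ?expf_neq0 ?pnatr_eq0.
transitivity (2 * (n == 0%N)%:R : R); last first.
  by case: (n) => [|n']; rewrite ?mulr0 // expr0 !mulr1.
rewrite -sumF mulr_sumr; apply: eq_bigr => i _.
rewrite /F -mulnBr !exprM sqrrN -{1}(subnK (leq_ord i)) exprD.
have -> : 2 ^+ 2 = 4 :> R by ring.
by field; rewrite expf_neq0 // pnatr_eq0.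
Qed.

Lemma eulval21_euler (E : nat -> R) : euler_numbers E -> forall n,
  eulval (2 : R) 1 (2 * n) = 4 ^+ n * E (2 * n)%N.
Proof.
move=> /euler_secant_rec hE n.
suff <- : eulval (2 : R) 1 (2 * n) / 4 ^+ n = E (2 * n)%N.
  by rewrite mulrC divfK // expf_neq0 // pnatr_eq0.
elim/ltn_ind: n => n IHn.
have := hE n; rewrite -(eulval21_rec n) !big_ord_recr /= binn !mul1r.
rewrite (eq_bigr (fun i : 'I_n => 'C(2 * n, 2 * i)%:R *
  (eulval (2 : R) 1 (2 * i) / 4 ^+ i))); first by move/addrI.
by move=> i _; rewrite IHn.
Qed.

(** * Identification of the type B Eulerian numbers *)

Lemma polynomial_eq_right (p q : {poly R}) :
  (\forall x \near (0 : R)^'+, p.[x] = q.[x]) -> p = q.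
Proof.
move=> pq; apply/polyP => i; apply/eqP; rewrite -subr_eq0 -coefB; apply/eqP.
apply: (@coef_eq0_of_bigO R _ i.+1 0) => //.
by apply: filterS pq => x e; rewrite hornerD hornerN e subrr normr0 mul0r.
Qed.

(** Shifting the summation index in the defining series, expanding
    [(2(j+1)+1)^m] and multiplying by [(1 - x)^(m+1)]. *)
Lemma eulerianB_rec (a : nat -> nat -> R) : eulerianB_numbers a ->
  forall m x, `|x| < 1 ->
  let b k := \sum_(0 <= i < k.+1) a k i * x ^+ i in
  b m = (1 - x) ^+ m.+1 +
    x * \sum_(k < m.+1) (2 * (1 - x)) ^+ (m - k) * b k * 'C(m, k)%:R.
Proof.
move=> ha m x x_lt1 b.
have x1_neq0 : 1 - x != 0.
  by rewrite subr_eq0 eq_sym lt_eqF // (le_lt_trans (ler_norm _)).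
pose S k N := series (fun j : nat => (2 * j + 1)%:R ^+ k * x ^+ j) N.
have S_cvg k : S k @ \oo --> (1 - x) ^- k.+1 * b k := ha k x x_lt1.
have S_rec N : S m N.+1 =
    1 + x * \sum_(k < m.+1) 2 ^+ (m - k) * S k N * 'C(m, k)%:R.
  rewrite /S seriesEnat /= big_nat_recl // expr0 muln0 add0n expr1n mulr1.
  congr (_ + _).
  transitivity (x * \sum_(0 <= j < N) \sum_(k < m.+1)
      2 ^+ (m - k) * ((2 * j + 1)%:R ^+ k * x ^+ j) * 'C(m, k)%:R).
    rewrite mulr_sumr; apply: eq_bigr => j _.
    rewrite mulnS -addnA natrD exprDn exprS mulrCA mulr_suml; congr (_ * _).
    by apply: eq_bigr => k _; rewrite -mulr_natr; ring.
  congr (_ * _); rewrite exchange_big; apply: eq_bigr => k _ /=.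
  by rewrite mulr_sumr mulr_suml.
have lim1 : S m N.+1 @[N --> \oo] --> (1 - x) ^- m.+1 * b m.
  by rewrite cvg_shiftS.
have lim2 : S m N.+1 @[N --> \oo] -->
    1 + x * \sum_(k < m.+1) 2 ^+ (m - k) * ((1 - x) ^- k.+1 * b k) * 'C(m, k)%:R.
  under eq_fun do rewrite S_rec.
  apply: cvgD; first exact: cvg_cst.
  apply: cvgMr; apply: cvg_big => [|k _]; first exact: add_continuous.
  apply: cvgMl; apply: cvgMr; exact: S_cvg.
have lim_eq : (1 - x) ^- m.+1 * b m = 1 + x *
    \sum_(k < m.+1) 2 ^+ (m - k) * ((1 - x) ^- k.+1 * b k) * 'C(m, k)%:R.
  by rewrite -(cvg_lim (@Rhausdorff R) lim1) (cvg_lim (@Rhausdorff R) lim2).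
rewrite -[LHS](mulVKf (expf_neq0 m.+1 x1_neq0)) lim_eq.
rewrite mulrDr mulr1; congr (_ + _); rewrite mulrCA; congr (_ * _).
rewrite mulr_sumr; apply: eq_bigr => k _.
have -> : (1 - x) ^+ m.+1 = (1 - x) ^+ (m - k) * (1 - x) ^+ k.+1.
  by rewrite -exprD addnS subnK // leq_ord.
by rewrite exprMn; field; rewrite expf_neq0.
Qed.

Lemma eulpoly_rec (a b x : R) m :
  (eulpoly a b m).[x] = b ^+ m * (1 - x) ^+ m.+1 +
    x * \sum_(k < m.+1)
      (a * (1 - x)) ^+ (m - k) * (eulpoly a b k).[x] * 'C(m, k)%:R.
Proof.
have /(congr1 (fun p => p.[x])) := eulpoly_translate a b m.
rewrite addrC eulpoly_shift.
rewrite !(hornerM, hornerD, hornerN, hornerX, hornerC, horner_exp).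
rewrite horner_sum (eq_bigr (fun k : 'I_m.+1 =>
  (a * (1 - x)) ^+ (m - k) * (eulpoly a b k).[x] * 'C(m, k)%:R)).
  by move=> ->; ring.
move=> k _; rewrite -polyC_natr.
by rewrite !(hornerM, hornerD, hornerN, hornerX, hornerC, horner_exp).
Qed.

Lemma eulerianB_eulpoly (a : nat -> nat -> R) : eulerianB_numbers a ->
  forall m k, (k <= m)%N -> a m k = (eulpoly (2 : R) 1 m)`_k.
Proof.
move=> ha m k le_km.
suff <- : \poly_(i < m.+1) a m i = eulpoly (2 : R) 1 m.
  by rewrite coef_poly ltnS le_km.
apply: polynomial_eq_right; near=> x.
have x_gt0 : 0 < x by near: x; exact: nbhs_right_gt.
have x_lt1 : x < 1 by near: x; exact: nbhs_right_lt.
rewrite horner_poly -(big_mkord xpredT (fun i => a m i * x ^+ i)).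
have {}x_lt1 : `|x| < 1 by rewrite gtr0_norm.
have ax_neq0 : 1 - x != 0.
  by rewrite subr_eq0 eq_sym lt_eqF // (le_lt_trans (ler_norm _)).
elim/ltn_ind: (m) => {le_km}m IHm.
have := eulerianB_rec ha m x_lt1; have := eulpoly_rec 2 1 x m.
rewrite /= expr1n mul1r !big_ord_recr /= subnn expr0 binn !mul1r !mulr1.
set q := _.[x]; set s := \sum_(_ <= _ < _) _.
rewrite (eq_bigr (fun k : 'I_m => (2 * (1 - x)) ^+ (m - k) *
  (\sum_(0 <= i < k.+1) a k i * x ^+ i) * 'C(m, k)%:R)); last first.
  by move=> i _; rewrite IHm.
(* In the recursion the term [k = m] is [x] times the left-hand side, so
   dividing by [1 - x] isolates order [m]. *)
move=> eq_q eq_s; apply: (mulIf ax_neq0).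
by move: eq_q eq_s; set t := \sum_(i < m) _; lra.
Unshelve. all: by end_near. Qed.

End NumberSequences.

(** * The two evaluations at 0 *)

Theorem proposition8p1 (R : realType) (E B : nat -> R)
    (eulB : nat -> nat -> R)
    (hE : euler_numbers E) (hB : bernoulli_numbers B)
    (hEulB : eulerianB_numbers eulB)
    (n : nat) (hn : (0 < n)%N) :
  (Xi eulB n).[0] =
    (-1) ^+ n / (2 ^+ (2 * n) * ((2 * n - 1)`!)%:R) * E (2 * n)%N
  /\
  (Lambda R n).[0] =
    (-1) ^+ n * 2 ^+ (2 * n + 1) * (2 ^+ (2 * n + 2) - 1)
      / ((2 ^+ (2 * n + 1) - 1) * (n + 1)%:R * ((2 * n)`!)%:R)
      * B (2 * n + 2)%N.
Proof.
rewrite /Xi /Lambda !hornerZ !horner0_even_sum // /coefCB /coefCA.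
have -> : coefC (eulB (2 * n - 1)%N) n 0 =
    coefC (fun k => (eulpoly (2 : R) 1 (2 * n - 1))`_k) n 0.
  rewrite !coefC_0; apply: eq_big_nat => k /andP[_ lt_kn].
  by rewrite (eulerianB_eulpoly hEulB) //; lia.
have -> : coefC (fun k => (eulerianA (2 * n) k)%:R) n 0 =
    coefC (fun k => (eulpoly (1 : R) 1 (2 * n))`_k) n 0.
  by rewrite !coefC_0; apply: eq_big_nat => k _; rewrite eulpoly11_coef.
have CB := coefC_0_eulpoly21 R hn.
have CA := coefC_0_eulpoly11 R hn.
set cB := coefC _ n 0 in CB *; set cA := coefC _ n 0 in CA *.
rewrite (eulval21_euler hE) in CB.
(* As [0 ^ m = 0] for [m > 0], the values for [b = 1] and [b = 0] are opposite. *)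
have := eulval_translate (1 : R) 0 (2 * n).+1.
rewrite addr0 (eulval10_bernoulli hB) expr0n mul0r => /eqP.
rewrite addr_eq0 => /eqP eulval11; rewrite eulval11 opprK in CA.
have sqr4 : 4 ^+ n = 2 ^+ (2 * n) :> R.
  by rewrite exprM; congr (_ ^+ _); rewrite -natrX.
split.
  have -> : cB = - (2 ^+ (2 * n) * E (2 * n)%N) / 4.
    by rewrite -sqr4 -CB -[cB *+ 4]mulr_natr mulfK // pnatr_eq0.
  have -> : (4 * n - 2 = 2 * n - 2 + 2 * n)%N by lia.
  have pow2n : 2 ^+ (2 * n) = 4 * 2 ^+ (2 * n - 2) :> R.
    have -> : 4 = 2 ^+ 2 :> R by rewrite -natrX.
    by rewrite -exprD; congr (_ ^+ _); lia.
  have pow_neq0 : 2 ^+ (2 * n - 2) != 0 :> R by rewrite expf_neq0 // pnatr_eq0.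
  rewrite exprD pow2n exprS.
  by field; rewrite fact_neq0 pow_neq0.
have -> : cA = 2 ^+ (2 * n).+2 *
    ((1 - 2 ^+ (2 * n).+2) * B (2 * n).+2 / (2 * n).+2%:R) / 2.
  by rewrite -CA -[cA *+ 2]mulr_natr mulfK // pnatr_eq0.
rewrite !addn1 !addn2.
have -> : (2 * n).+2%:R = 2 * n.+1%:R :> R by rewrite -natrM; congr (_%:R); lia.
have n1_neq0 : n.+1%:R != 0 :> R by rewrite pnatr_eq0.
have pow_neq0 : 2 ^+ (2 * n).+1 - 1 != 0 :> R.
  by rewrite subr_eq0 gt_eqF // exprn_egt1 // ltr1n.
rewrite (exprS (-1)) (exprS 2 (2 * n).+1).
by field; rewrite fact_neq0 nat1r n1_neq0 pow_neq0.
Qed.
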